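(* Computing an $\epsilon$-MVI solution requires $\Omega(1/\epsilon)$ oracle evaluations of $F$, even when an MVI solution is guaranteed to exist and $d=1$. That is, for all sufficiently small $\epsilon>0$, any (possibly randomized) algorithm that, on every problem $\mathrm{VI}(\mathcal X,F)$ with $d=1$ satisfying the Minty condition, outputs with constant probability an $\epsilon$-MVI solution must make $\Omega(1/\epsilon)$ evaluations of $F$. Moreover, when $d$ is large, it requires $\Omega(2^d)$ oracle evaluations even when $\epsilon$ is an absolute constant. That is, there is an absolute constant $\epsilon>0$ such that any (possibly randomized) algorithm that, on every $d$-dimensional problem $\mathrm{VI}(\mathcal X,F)$ satisfying the Minty condition, outputs with constant probability an $\epsilon$-MVI solution must make $\Omega(2^d)$ evaluations of $F$.
   Context: $\mathcal X\subseteq\mathbb R^d$ is convex and compact and $F:\mathcal X\to\mathbb R^d$ is Lipschitz continuous; the algorithm knows $\mathcal X$ and accesses $F$ only through an oracle returning $F(x)$ at queried points $x\in\mathcal X$. An $\epsilon$-MVI solution is a point $x\in\mathcal X$ with $\langle F(x'),x'-x\rangle\ge-\epsilon$ for all $x'\in\mathcal X$; an MVI solution is the case $\epsilon=0$. The Minty condition is that an MVI solution exists. *)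

(* Defs.v *)
From HB Require Import structures.
From mathcomp Require Import all_boot all_order all_algebra.
From mathcomp Require Import all_classical all_reals all_analysis.
Import Order.TTheory GRing.Theory Num.Theory.
Import numFieldNormedType.Exports.

Set Implicit Arguments.
Unset Strict Implicit.
Unset Printing Implicit Defensive.

Local Open Scope classical_set_scope.
Local Open Scope ring_scope.

Section VariationalInequality.
Context {R : realType} {d : nat}.
Implicit Types (X : set 'rV[R]_d) (F : 'rV[R]_d -> 'rV[R]_d).

Definition dot (x y : 'rV[R]_d) : R := \sum_(i < d) x 0 i * y 0 i.

(* The library norm on row vectors is the sup norm, hence this definition. *)
Definition norm2 (x : 'rV[R]_d) : R := Num.sqrt (dot x x).

Definition lipschitz2 (K : R) X F : Prop :=
  forall x y, X x -> X y -> norm2 (F x - F y) <= K * norm2 (x - y).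

(* An operator X -> R^d is represented by a total function F of which only the
   values on X are ever used. *)
Definition MVI_solution (eps : R) X F (x : 'rV[R]_d) : Prop :=
  X x /\ forall x', X x' -> - eps <= dot (F x') (x' - x).

Definition Minty X F : Prop := exists x, MVI_solution 0 X F x.

(* Problems VI(X, F) satisfying the Minty condition, normalised by a bound L on
   the Lipschitz constant of F and a bound B on the coordinates of the points
   of X.  For L = B = +oo this is the class of all problems satisfying the
   Minty condition (a compact X is bounded, so B = +oo is no constraint).  For
   finite L and B the class can be solved with finitely many evaluations. *)
Definition VI_Minty (L B : \bar R) X F : Prop :=
  [/\ convex_set (X : set (convex_lmodType 'rV[R]_d)),
      compact X,
      forall x i, X x -> (`|x 0 i|%:E <= B)%E,
      exists2 K : R, (K%:E <= L)%E & lipschitz2 K X F &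
      Minty X F].

End VariationalInequality.

Section OracleAlgorithms.
Context {R : realType} {d : nat}.

Inductive action := Query of 'rV[R]_d | Output of 'rV[R]_d.

(* A deterministic adaptive algorithm: the next action as a function of the
   oracle answers received so far, in chronological order. *)
Definition strategy := seq 'rV[R]_d -> action.

(* Output of A, continued from the answers h, if it is produced after at most
   q further evaluations of F; the oracle answers only at points of X. *)
Fixpoint run (X : set 'rV[R]_d) (F : 'rV[R]_d -> 'rV[R]_d) (A : strategy)
    (q : nat) (h : seq 'rV[R]_d) : option 'rV[R]_d :=
  match A h with
  | Output x => Some x
  | Query x =>
      if q is q'.+1 then
        if `[< X x >] then run X F A q' (rcons h (F x)) else None
      else None
  end.

(* A randomized algorithm is a deterministic one chosen by a random seed w, and
   it is told the domain X.  The set E makes sense of "with probability at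
   least p" without requiring w |-> A w X to be measurable in any sense; if the
   success event is measurable, it can itself be taken as E. *)
Definition solves_whp {disp : measure_display} {W : measurableType disp}
    (P : probability W R) (A : W -> set 'rV[R]_d -> strategy) (q : nat)
    (eps p : R) (X : set 'rV[R]_d) (F : 'rV[R]_d -> 'rV[R]_d) : Prop :=
  exists E : set W,
    [/\ measurable E,
        (forall w, E w -> exists2 x,
           run X F (A w X) q [::] = Some x & MVI_solution eps X F x) &
        (p%:E <= P E)%E].

End OracleAlgorithms.

Arguments action R d : clear implicits.
Arguments strategy R d : clear implicits.

(* Main.v *)
(* If the operators [F_i], i in a finite set I, have pairwise disjoint supports,
   every query of a deterministic algorithm is answered 0 for all but one of the
   [F_i] still undistinguished.  Hence, if moreover no point is an
   eps-MVI solution for more than m of them, q queries are enough for at most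
   q + m of the [F_i], and averaging over the seed gives p * |I| <= q + m.
   - d = 1: split [0, b] into n ~ p / eps cells and let F_i be negative on the
     left half of cell i, positive on the right half and 0 elsewhere.  Only
     points within about (p / 8) b of the center of cell i solve F_i, so that m
     is about p n / 4.
   - d large: let F_s be supported on the orthant of the sign vector s and point
     in the direction - s; the corner b s of the box solves F_s.  Testing at
     (b / 2) s shows that a solution x satisfies <s, x> >= d b / 4, which by
     Chebyshev's inequality holds for at most 16 * 2^d / d sign vectors. *)
Require Import Defs.
From HB Require Import structures.
From mathcomp Require Import all_boot all_order all_algebra.
From mathcomp Require Import all_classical all_reals all_analysis.
From mathcomp Require Import measurable_realfun ring lra.
Import Order.TTheory GRing.Theory Num.Theory.
Import numFieldNormedType.Exports.

Set Implicit Arguments.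
Unset Strict Implicit.
Unset Printing Implicit Defensive.

Local Open Scope classical_set_scope.
Local Open Scope ring_scope.

(** * Counting successes of one algorithm against operators with disjoint supports *)

Lemma card_success_le (R : realType) (d : nat) (X : set 'rV[R]_d) (I : finType)
    (F : I -> 'rV[R]_d -> 'rV[R]_d) (eps m : R) :
  (forall y i j, F i y != 0 -> F j y != 0 -> i = j) ->
  (forall x, (#|[pred i | `[< MVI_solution eps X (F i) x >]]|)%:R <= m) ->
  forall (a : strategy R d) (q : nat) (h : seq 'rV[R]_d),
  (#|[pred i | `[< exists2 x, run X (F i) a q h = Some x &
                              MVI_solution eps X (F i) x >]]|)%:R <= q%:R + m.
Proof.
move=> Fdisj sol_le a; have m0 : 0 <= m by exact: le_trans (sol_le 0).
elim=> [|q IHq] h; case ah: (a h) => [y|y].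
- rewrite eq_card0 ?addr_ge0// => i; rewrite inE /= ah.
  by apply/asboolP => -[].
- rewrite add0r (le_trans _ (sol_le y))// ler_nat; apply/subset_leq_card.
  by apply/fintype.subsetP => i; rewrite !inE /= ah => -[x [<-]].
- case: (pselect (X y)) => Xy; last first.
    rewrite eq_card0 ?addr_ge0// => i; rewrite inE /= ah (asboolF Xy).
    by apply/asboolF => -[].
  (* At most one operator answers [y] with a nonzero value; it is charged to this query. All others
     share the history [rcons h 0], to which the induction hypothesis applies. *)
  set S := [pred i | _]; set S' := [pred i | F i y != 0].
  set S'' := [pred i | `[< exists2 x, run X (F i) a q (rcons h 0) = Some x &
                              MVI_solution eps X (F i) x >]].
  have S'1 : (#|S'| <= 1)%N.
    by apply/card_le1_eqP => i j; rewrite !inE => Fi Fj; exact: Fdisj Fj Fi.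
  have SS : (#|S| <= #|S'| + #|S''|)%N.
    rewrite -cardUI (leq_trans _ (leq_addr _ _))//.
    apply/subset_leq_card/fintype.subsetP => i; rewrite !inE /= ah (asboolT Xy).
    by case: (eqVneq (F i y) 0) => [-> ?|//]; apply/orP; right; apply/asboolP.
  rewrite -natr1 addrAC -lerBlDr (le_trans _ (IHq (rcons h 0)))//.
  by rewrite lerBlDr natr1 ler_nat (leq_trans SS)// addnC -addn1 leq_add2l.
- rewrite (@le_trans _ _ m)// ?lerDr//.
  rewrite (le_trans _ (sol_le y))// ler_nat; apply/subset_leq_card.
  by apply/fintype.subsetP => i; rewrite !inE /= ah => -[x [<-]].
Qed.

(** Integrate the number of events containing [w]: it is at most [K] pointwise, and its integral is
    the sum of the probabilities. *)
Lemma prob_sum_le (R : realType) (disp : measure_display)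
    (W : measurableType disp) (P : probability W R) (I : finType)
    (E : I -> set W) (p K : R) :
  (forall i, measurable (E i)) -> (forall i, (p%:E <= P (E i))%E) ->
  (forall w, (#|[pred i | `[< E i w >]]|)%:R <= K) ->
  p * #|I|%:R <= K.
Proof.
move=> mE pE cE.
have mI i : measurable_fun [set: W] (EFin \o (\1_(E i) : W -> R)).
  by apply/measurable_EFinP; exact: measurable_indic.
have : (\int[P]_(w in setT) (\sum_(i <- index_enum I) (\1_(E i) w)%:E) <=
        \int[P]_(w in setT) cst K%:E w)%E.
  apply: ge0_le_integral => //.
  - by move=> w _; apply: sume_ge0 => i _; rewrite lee_fin.
  - by apply: emeasurable_sum => i; exact: mI.
  - move=> w _; rewrite sumEFin lee_fin (le_trans _ (cE w))//.
    rewrite -sum1_card natr_sum [leRHS]big_mkcond /=; apply: ler_sum => i _.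
    rewrite inE indicE; case: asboolP => Ew.
      by rewrite mem_set.
    by rewrite memNset.
rewrite integral_cst// [X in (_ * X)%E]probability_setT mule1.
rewrite ge0_integral_sum//.
move=> leK; rewrite -lee_fin (le_trans _ leK)//.
apply: (@le_trans _ _ (\sum_(i : I) p%:E)%E).
  by rewrite sumEFin sumr_const mulr_natr.
apply: lee_sum => i _; rewrite integral_indic// setIT; exact: pE.
Qed.

Lemma oracle_lower_bound (R : realType) (d : nat) (X : set 'rV[R]_d)
    (I : finType) (F : I -> 'rV[R]_d -> 'rV[R]_d) (eps p m : R)
    (disp : measure_display) (W : measurableType disp) (P : probability W R)
    (A : W -> set 'rV[R]_d -> strategy R d) (q : nat) :
  (forall y i j, F i y != 0 -> F j y != 0 -> i = j) ->
  (forall x, (#|[pred i | `[< MVI_solution eps X (F i) x >]]|)%:R <= m) ->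
  (forall i, solves_whp P A q eps p X (F i)) ->
  p * #|I|%:R <= q%:R + m.
Proof.
move=> Fdisj sol_le /choice[E solE].
apply: (@prob_sum_le R disp W P I E p (q%:R + m)) => [i|i|w].
- by have [] := solE i.
- by have [] := solE i.
- apply: le_trans (card_success_le Fdisj sol_le (A w X) q [::]).
  rewrite ler_nat; apply/subset_leq_card/fintype.subsetP => i; rewrite !inE.
  by have [_ + _] := solE i => /(_ w).
Qed.

(** * Boxes as domains; scalar and norm estimates *)

Definition box {R : realType} {d : nat} (b : R) : set 'rV[R]_d :=
  [set x | forall i, `|x 0 i| <= b].

Lemma compact_box (R : realType) (d : nat) (b : R) : compact (@box R d b).
Proof.
have -> : @box R d b = [set v | forall i, `[- b, b]%classic (v ord0 i)].
  by apply/seteqP; split=> x /= xb i; have := xb i; rewrite in_itv/= ler_norml.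
apply: (@rV_compact R d (fun=> `[- b, b]%classic)) => _.
exact: segment_compact.
Qed.

Lemma convex_box (R : realType) (d : nat) (b : R) :
  convex_set (@box R d b : set (convex_lmodType 'rV[R]_d)).
Proof.
move=> x y t; rewrite !inE => xb yb i.
have t0 : 0 <= t%:num by exact: ge0.
have t1 : 0 <= 1 - t%:num by rewrite subr_ge0; exact: le1.
(* The abstract convex combination unfolds to this expression. *)
change (`|(t%:num *: (x : 'rV_d) + (1 - t%:num) *: (y : 'rV_d)) 0 i| <= b).
rewrite !mxE (le_trans (ler_normD _ _))// !normrM (ger0_norm t0) (ger0_norm t1).
have -> : b = t%:num * b + (1 - t%:num) * b by ring.
by rewrite lerD// ler_wpM2l.
Qed.

Lemma VI_Minty_box (R : realType) (d : nat) (L B : \bar R) (l b : R)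
    (F : 'rV[R]_d -> 'rV[R]_d) :
  (l%:E <= L)%E -> (b%:E <= B)%E -> lipschitz2 l (box b) F ->
  Minty (box b) F -> VI_Minty L B (box b) F.
Proof.
move=> lL bB Fl FM; split => //.
- exact: convex_box.
- exact: compact_box.
- by move=> x i /(_ i) xb; rewrite (le_trans _ bB)// lee_fin.
- by exists l.
Qed.

(** [L] and [B] may be infinite; the hard instances use finite positive constants below them. *)
Lemma gt0_fin_lb (R : realType) (x : \bar R) :
  (0 < x)%E -> exists2 r : R, 0 < r & (r%:E <= x)%E.
Proof.
case: x => [r||]//; first by rewrite lte_fin => r0; exists r.
by move=> _; exists 1; rewrite ?ltr01// leey.
Qed.

Lemma dist_min_le (R : realDomainType) (K a b c e : R) :
  `|a - c| <= K -> `|b - e| <= K -> `|Num.min a b - Num.min c e| <= K.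
Proof.
rewrite !ler_distl /Num.min => ? ?.
by case: ltP => ?; case: ltP => ?; lra.
Qed.

Lemma dist_max_le (R : realDomainType) (K a b c e : R) :
  `|a - c| <= K -> `|b - e| <= K -> `|Num.max a b - Num.max c e| <= K.
Proof.
rewrite !ler_distl /Num.max => ? ?.
by case: ltP => ?; case: ltP => ?; lra.
Qed.

Lemma normr_le_norm2 (R : realType) (d : nat) (x : 'rV[R]_d) (i : 'I_d) :
  `|x 0 i| <= norm2 x.
Proof.
rewrite -sqrtr_sqr ler_wsqrtr// /dot (bigD1 i)//= expr2 lerDl.
by apply: sumr_ge0 => j _; rewrite -expr2 sqr_ge0.
Qed.

Lemma norm2Z (R : realType) (d : nat) (a : R) (x : 'rV[R]_d) :
  norm2 (a *: x) = `|a| * norm2 x.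
Proof.
rewrite /norm2 -sqrtr_sqr -sqrtrM ?sqr_ge0//; congr Num.sqrt.
by rewrite /dot mulr_sumr; apply: eq_bigr => i _; rewrite !mxE; ring.
Qed.

Lemma dotZl (R : realType) (d : nat) (a : R) (x y : 'rV[R]_d) :
  dot (a *: x) y = a * dot x y.
Proof.
by rewrite /dot mulr_sumr; apply: eq_bigr => i _; rewrite !mxE mulrA.
Qed.

(** * Large dimension: operators supported on orthants *)

Section Orthants.
Context {R : realType} {d : nat} (l b : R).
Hypotheses (l0 : 0 < l) (b0 : 0 < b).
Implicit Types (s : {ffun 'I_d -> bool}) (x : 'rV[R]_d).

Definition signs s : 'rV[R]_d := \row_i (-1) ^+ s i.

(* Capped sup-norm distance of x to the complement of the orthant of s. *)
Definition depth s x : R :=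
  \big[Num.min/b]_i Num.max 0 (signs s 0 i * x 0 i).

(** As [signs s] has norm [sqrt d <= d], the factor [l / d] keeps the Lipschitz constant below [l].
    It also cancels the factor [d] of the inner products with [signs s], so that [eps] need not
    depend on [d]. *)
Definition orthant_op s x : 'rV[R]_d := (- (l / d%:R * depth s x)) *: signs s.

Lemma signs_sqr s i : signs s 0 i * signs s 0 i = 1.
Proof. by rewrite mxE -signr_addb addbb. Qed.

Lemma depth_ge0 s x : 0 <= depth s x.
Proof.
by apply: le_bigmin => [|i _]; [exact: ltW|rewrite le_max lexx].
Qed.

Lemma depth_lipschitz s x y : `|depth s x - depth s y| <= norm2 (x - y).
Proof.
rewrite /depth; elim/big_ind2 : _ => [|u1 u2 v1 v2|i _].
- by rewrite subrr normr0 sqrtr_ge0.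
- exact: dist_min_le.
- apply: dist_max_le; first by rewrite subrr normr0 sqrtr_ge0.
  rewrite -mulrBr normrM [signs s 0 i]mxE normr_sign mul1r.
  by have := normr_le_norm2 (x - y) i; rewrite !mxE.
Qed.

(** Nonzero depth makes every [signs s 0 i * x 0 i] positive, so the signs of [x] determine [s]. *)
Lemma depth_neq0 s x : depth s x != 0 ->
  s = [ffun i => x 0 i < 0].
Proof.
move=> dn0; have dgt0 : 0 < depth s x by rewrite lt_neqAle eq_sym dn0 depth_ge0.
apply/ffunP => i; rewrite ffunE.
have : 0 < Num.max 0 (signs s 0 i * x 0 i).
  exact: lt_le_trans dgt0 (bigmin_le _ _ _).
rewrite lt_max ltxx /= mxE; case: (s i) => /= xi; first by apply/esym; lra.
by apply/esym; apply: le_gtF; lra.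
Qed.

Lemma orthant_op_disjoint x s s' :
  orthant_op s x != 0 -> orthant_op s' x != 0 -> s = s'.
Proof.
have H t : orthant_op t x != 0 -> t = [ffun i => x 0 i < 0].
  move=> tx; apply: depth_neq0; apply: contraNneq tx => tx.
  by rewrite /orthant_op tx mulr0 oppr0 scale0r.
by move=> /H -> /H ->.
Qed.

Lemma dot_signs s : dot (signs s) (signs s) = d%:R.
Proof.
rewrite /dot (eq_bigr (fun=> 1)) => [|i _]; last exact: signs_sqr.
by rewrite sumr_const card_ord.
Qed.

Lemma orthant_op_lipschitz s X : lipschitz2 l X (orthant_op s).
Proof.
move=> x y _ _.
rewrite /orthant_op -scalerBl norm2Z.
have -> : - (l / d%:R * depth s x) - - (l / d%:R * depth s y) =
  - (l / d%:R * (depth s x - depth s y)) by ring.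
have ld0 : 0 <= l / d%:R by rewrite divr_ge0// ltW.
rewrite normrN normrM (ger0_norm ld0) mulrAC.
apply: ler_pM (depth_lipschitz s x y) => //.
  by rewrite mulr_ge0// sqrtr_ge0.
case: (posnP d) => [d0|d0].
  (* For [d = 0] the convention [0^-1 = 0] makes the left-hand side zero. *)
  by rewrite [X in _ / X%:R]d0 invr0 mulr0 mul0r ltW.
rewrite -mulrA ger_pMr// mulrC ler_pdivrMr ?ltr0n// mul1r.
rewrite /norm2 dot_signs -[leRHS]ger0_norm// -sqrtr_sqr ler_wsqrtr//.
by rewrite -natrX ler_nat -mulnn leq_pmull.
Qed.

Lemma dot_signsB s c x :
  dot (signs s) (c *: signs s - x) = c * d%:R - dot (signs s) x.
Proof.
rewrite -(dot_signs s) /dot mulr_sumr -sumrB; apply: eq_bigr => i _.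
by rewrite !mxE; ring.
Qed.

(** The corner [b *: signs s] maximises [dot (signs s)] over the box, and the operator is a
    nonpositive multiple of [signs s]. *)
Lemma orthant_op_minty s : Minty (box b) (orthant_op s).
Proof.
exists (b *: signs s); split=> [i|x xb].
  by rewrite !mxE normrM normr_sign mulr1 ger0_norm// ltW.
have dotE : dot (signs s) (x - b *: signs s) = - (b * d%:R - dot (signs s) x).
  rewrite -dot_signsB /dot -sumrN.
  by apply: eq_bigr => i _; rewrite !mxE; ring.
rewrite oppr0 /orthant_op dotZl dotE mulrNN mulr_ge0//.
  by rewrite mulr_ge0 ?depth_ge0// divr_ge0// ltW.
rewrite subr_ge0 /dot mulr_natr -[X in _ *+ X]card_ord -sumr_const.
apply: ler_sum => i _; rewrite (le_trans (ler_norm _))// normrM.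
by rewrite mxE normr_sign mul1r.
Qed.

(** Expand the square: distinct coordinates of a uniform sign vector are uncorrelated, because
    flipping sign [i] negates the product, so only the diagonal survives. *)
Lemma sum_dot_signs_sqr x :
  \sum_s dot (signs s) x ^+ 2 = 2 ^+ d * dot x x.
Proof.
have orth i j : i != j -> \sum_s signs s 0 i * signs s 0 j = 0 :> R.
  move=> ij; pose flip s : {ffun 'I_d -> bool} :=
    [ffun k => if k == i then ~~ s k else s k].
  have flipK : involutive flip.
    by move=> s; apply/ffunP => k; rewrite !ffunE; case: eqP; rewrite ?negbK.
  have : \sum_s signs s 0 i * signs s 0 j =
         - \sum_s signs s 0 i * signs s 0 j :> R.
    rewrite {1}(reindex_inj (inv_inj flipK)) -sumrN; apply: eq_bigr => s _.
    by rewrite !mxE !ffunE eqxx eq_sym (negbTE ij) signrN mulNr.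
  lra.
transitivity (\sum_i \sum_j x 0 i * x 0 j * \sum_s signs s 0 i * signs s 0 j).
  under eq_bigr => s _ do rewrite expr2 /dot big_distrlr /=.
  rewrite exchange_big; apply: eq_bigr => i _.
  rewrite exchange_big; apply: eq_bigr => j _.
  by rewrite mulr_sumr; apply: eq_bigr => s _; ring.
rewrite /dot mulr_sumr; apply: eq_bigr => i _; rewrite (bigD1 i)//=.
rewrite [X in _ + X]big1 ?addr0 => [|j ji]; last first.
  by rewrite orth ?mulr0 1?eq_sym.
under eq_bigr => s _ do rewrite signs_sqr.
by rewrite sumr_const card_ffun card_bool card_ord natrX mulrC.
Qed.

(* Chebyshev's inequality for [dot (signs s) x], which has mean 0 and variance
   at most [d * b ^+ 2] under the uniform distribution on [s]. *)
Lemma card_dot_signs_le x : box b x -> (0 < d)%N ->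
  (#|[pred s | d%:R * b / 4 <= dot (signs s) x]|)%:R <= 16 * 2 ^+ d / d%:R :> R.
Proof.
move=> xb d0; have dR : 0 < d%:R :> R by rewrite ltr0n.
have dxx : dot x x <= d%:R * b ^+ 2.
  rewrite /dot mulr_natl -[X in _ *+ X]card_ord -sumr_const.
  apply: ler_sum => i _; rewrite -expr2 -[leLHS]real_normK ?num_real//.
  by rewrite lerXn2r// nnegrE ltW.
set N := #|_|; have db0 : 0 < d%:R * b / 4 by rewrite divr_gt0// mulr_gt0.
have : N%:R * (d%:R * b / 4) ^+ 2 <= 2 ^+ d * dot x x.
  rewrite -sum_dot_signs_sqr mulr_natl -sumr_const big_mkcond /=.
  apply: ler_sum => s _; rewrite inE; case: ifP => [sx|_]; last exact: sqr_ge0.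
  by rewrite lerXn2r// nnegrE ltW// (lt_le_trans db0).
move=> /le_trans/(_ (ler_wpM2l (exprn_ge0 _ _) dxx)) => /(_ (ler0n _ _)).
have -> : N%:R * (d%:R * b / 4) ^+ 2 = (N%:R * d%:R / 16) * (d%:R * b ^+ 2).
  by field.
rewrite ler_pM2r ?mulr_gt0 ?exprn_gt0//.
by rewrite ler_pdivlMr// ler_pdivrMr// mulrC [_ * 16]mulrC.
Qed.

(** The depth at the test point [b / 2 *: signs s] is at least [b / 2]. Were the conclusion false,
    the inner product there would be at most [- (l * b ^+ 2 / 8)]. *)
Lemma orthant_op_good x s : (0 < d)%N ->
  MVI_solution (l * b ^+ 2 / 16) (box b) (orthant_op s) x ->
  d%:R * b / 4 <= dot (signs s) x.
Proof.
move=> d0 [_ /(_ (b / 2 *: signs s)) sol]; rewrite leNgt; apply/negP => small.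
have dR : 0 < d%:R :> R by rewrite ltr0n.
have b2 : 0 < b / 2 by rewrite divr_gt0.
have bb : b / 2 <= b by rewrite ler_pdivrMr// ler_pMr// ler1n.
have /sol : box b (b / 2 *: signs s).
  by move=> i; rewrite !mxE normrM normr_sign mulr1 gtr0_norm.
rewrite /orthant_op dotZl dot_signsB mulNr lerN2; apply/negP; rewrite -ltNge.
have depth_ge : b / 2 <= depth s (b / 2 *: signs s).
  apply: le_bigmin => [//|i _].
  by rewrite [X in Num.max _ (_ * X)]mxE mulrCA signs_sqr mulr1 le_max lexx
    orbT.
have lb0 : 0 < l * b by rewrite mulr_gt0.
apply: (@lt_le_trans _ _ (l / d%:R * (b / 2) * (d%:R * b / 4))).
  have -> : l / d%:R * (b / 2) * (d%:R * b / 4) = l * b ^+ 2 / 8.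
    by field; rewrite gt_eqF.
  have : 0 < l * b ^+ 2 by rewrite mulr_gt0// exprn_gt0.
  lra.
have ld0 : 0 <= l / d%:R by rewrite divr_ge0// ltW.
apply: ler_pM => //; last by nra.
- by rewrite mulr_ge0//; lra.
- by rewrite divr_ge0// ltW// mulr_gt0.
- exact: ler_wpM2l.
Qed.

End Orthants.

(** * Dimension one: operators supported on cells of an interval *)

Lemma card_ord_diam (R : realType) (n : nat) (A : pred 'I_n) (k : R) :
  0 <= k -> (forall i j, A i -> A j -> i%:R - j%:R <= k) -> #|A|%:R <= k + 1.
Proof.
move=> k0 diamA; case: (pickP A) => [i0 Ai0|A0]; last first.
  by rewrite eq_card0// addr_ge0.
case: (arg_minnP (fun i : 'I_n => i : nat) Ai0) => i Ai imin.
case: (arg_maxnP (fun i : 'I_n => i : nat) Ai0) => j Aj jmax.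
have ij : (i <= j)%N by exact: imin.
(* [A] lies between its least index [i] and its greatest index [j]. *)
have cardA : (#|A| <= j.+1 - i)%N.
  rewrite cardE -(size_map val) -(size_iota i (j.+1 - i)).
  apply: uniq_leq_size.
    by rewrite map_inj_uniq ?enum_uniq//; exact: val_inj.
  move=> _ /mapP[t + ->]; rewrite mem_enum mem_iota => At.
  by rewrite imin//= (subnKC (leqW ij)) ltnS; exact: jmax.
apply: (@le_trans _ _ (j.+1 - i)%:R); first by rewrite ler_nat.
by rewrite natrB ?leqW// -natr1 addrAC lerD2r diamA.
Qed.

Section Cells.
Context {R : realType} (l b : R) (n : nat).
Hypotheses (l0 : 0 < l) (b0 : 0 < b) (n0 : (0 < n)%N).
Implicit Types (i j : 'I_n) (x y : 'rV[R]_1).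

(** Hat function on [[0, h]] with slopes 1 and -1 and peak [h / 2] at the midpoint. *)
Definition tent (h u : R) : R := Num.max 0 (Num.min u (h - u)).

Lemma tent_lipschitz h u v : `|tent h u - tent h v| <= `|u - v|.
Proof.
apply: dist_max_le; first by rewrite subrr normr0.
apply: dist_min_le => //; rewrite distrC.
by rewrite (_ : h - v - (h - u) = u - v)//; ring.
Qed.

Lemma tent_ge0 h u : 0 <= tent h u. Proof. by rewrite le_max lexx. Qed.

Lemma tent_neq0 h u : tent h u != 0 -> 0 < u < h.
Proof.
move=> tn0; have : 0 < tent h u by rewrite lt_neqAle eq_sym tn0 tent_ge0.
by rewrite lt_max ltxx lt_min subr_gt0.
Qed.

Lemma tent_le0 h u : u <= 0 -> tent h u = 0.
Proof.
by move=> u0; apply: contraTeq u0 => /tent_neq0/andP[]; rewrite -ltNge.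
Qed.

(** Half the width of each of the [n] equal cells of [[0, b]]. *)
Definition radius : R := b / n%:R / 2.

Definition center i : R := (i.*2.+1)%:R * radius.

(* Negative just left of [center i], positive just right of it, and zero
   outside the cell of that center: an approximate solution has to be near the
   center. *)
Definition cell_op i x : 'rV[R]_1 :=
  const_mx (l / 2 * (tent radius (x 0 0 - center i) -
                     tent radius (center i - x 0 0))).

Lemma radius_gt0 : 0 < radius.
Proof. by rewrite !divr_gt0// ltr0n. Qed.

Lemma center_le i : radius <= center i <= b - radius.
Proof.
have r0 := radius_gt0.
have bE : b = n.*2%:R * radius.
  by rewrite /radius -muln2 natrM; field; rewrite pnatr_eq0 -lt0n.
rewrite /center [X in _ <= X - _]bE lerBrDr.
rewrite ler_peMl ?(ltW r0)// ?ler1n//= -[X in _ + X]mul1r -mulrDl.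
by rewrite ler_wpM2r ?(ltW r0)// natr1 ler_nat -doubleS leq_double.
Qed.

Lemma centerB i j : center i - center j = (i%:R - j%:R) * (2 * radius).
Proof.
rewrite /center -[in X in X - _]natr1 -[in X in _ - X]natr1 -!muln2 !natrM.
by ring.
Qed.

Lemma norm2_rV1 x : norm2 x = `|x 0 0|.
Proof. by rewrite /norm2 /dot big_ord1 -expr2 sqrtr_sqr. Qed.

Lemma dot_rV1 x y : dot x y = x 0 0 * y 0 0.
Proof. by rewrite /dot big_ord1. Qed.

Lemma cell_op_near x i : cell_op i x != 0 -> `|x 0 0 - center i| < radius.
Proof.
move=> opx; rewrite ltr_norml.
have [u0|u0] := eqVneq (tent radius (x 0 0 - center i)) 0.
  have [v0|/tent_neq0/andP[]] := eqVneq (tent radius (center i - x 0 0)) 0.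
    move: opx; rewrite /cell_op u0 v0 subrr mulr0.
    by case/eqP; apply/matrixP => ? ?; rewrite !mxE.
  by move=> ? ?; have := radius_gt0; lra.
by have /andP[? ?] := tent_neq0 u0; have := radius_gt0; lra.
Qed.

(** Two centers within [radius] of [x] are less than [2 * radius] apart, whereas distinct centers
    are at least that far apart. *)
Lemma cell_op_disjoint x i j : cell_op i x != 0 -> cell_op j x != 0 -> i = j.
Proof.
move=> /cell_op_near ix /cell_op_near jx; apply/val_inj/eqP => /=.
have r2 : 0 < 2 * radius by rewrite mulr_gt0 ?radius_gt0.
have : `|(i%:R - j%:R) * (2 * radius)| < 2 * radius.
  by rewrite -centerB; move: ix jx; rewrite !ltr_norml; lra.
rewrite normrM (gtr0_norm r2) -[ltRHS]mul1r (ltr_pM2r r2) ltr_norml.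
case: ltngtP => // ij; rewrite -(ler_nat R) -natr1 in ij; lra.
Qed.

(** Each of the two tents is 1-Lipschitz, which the factor [l / 2] compensates. *)
Lemma cell_op_lipschitz i X : lipschitz2 l X (cell_op i).
Proof.
move=> x y _ _; rewrite !norm2_rV1 !mxE -mulrBr normrM gtr0_norm ?divr_gt0//.
have H1 := tent_lipschitz radius (x 0 0 - center i) (y 0 0 - center i).
have H2 := tent_lipschitz radius (center i - y 0 0) (center i - x 0 0).
rewrite (_ : _ - _ - (_ - _) = x 0 0 - y 0 0) in H1; last ring.
rewrite (_ : _ - _ - (_ - _) = x 0 0 - y 0 0) in H2; last ring.
have -> : l * `|x 0 0 - y 0 0| = l / 2 * (`|x 0 0 - y 0 0| + `|x 0 0 - y 0 0|).
  by field.
apply: ler_wpM2l; first by rewrite divr_ge0// ltW.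
rewrite opprB (addrC (tent _ (center i - y 0 0))) addrACA (addrC (- _)).
rewrite (le_trans (ler_normD _ _))//.
exact: lerD.
Qed.

Lemma cell_op_minty i : Minty (box b) (cell_op i).
Proof.
have /andP[c0 cb] := center_le i; have r0 := radius_gt0.
exists (const_mx (center i)); split=> [j|x _].
  by rewrite mxE ger0_norm; lra.
rewrite oppr0 dot_rV1 !mxE -mulrA mulr_ge0 ?divr_ge0 ?(ltW l0)//.
have [xc|cx] := leP (x 0 0) (center i).
  by rewrite tent_le0 ?subr_le0// sub0r mulNr -mulrN mulr_ge0 ?tent_ge0//; lra.
rewrite (@tent_le0 _ (center i - _)); last lra.
by rewrite subr0 mulr_ge0 ?tent_ge0//; lra.
Qed.

(** Test at the peaks of the two tents, [center i] plus or minus [radius / 2], where the operator is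
    plus or minus [l * radius / 4]. *)
Lemma cell_op_good eps x i : MVI_solution eps (box b) (cell_op i) x ->
  `|x 0 0 - center i| <= 4 * eps / (l * radius) + radius / 2.
Proof.
have /andP[c0 cb] := center_le i; have r0 := radius_gt0.
move=> [_ sol]; set h := radius in c0 cb r0 *.
have tent_mid : tent h (h / 2) = h / 2.
  by rewrite /tent (_ : h - h / 2 = h / 2) ?minxx ?max_r//; lra.
have tent_mid' : tent h (- (h / 2)) = 0 by rewrite tent_le0//; lra.
have lh : 0 < l * h by rewrite mulr_gt0.
have solR : (x 0 0 - center i - h / 2) * (l * h) <= 4 * eps.
  have /sol : box b (const_mx (center i + h / 2) : 'rV[R]_1).
    by move=> j; rewrite mxE ger0_norm; lra.
  rewrite dot_rV1 !mxE addrAC subrr add0r opprD addrA subrr sub0r.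
  rewrite tent_mid tent_mid' subr0; nra.
have solL : (center i - x 0 0 - h / 2) * (l * h) <= 4 * eps.
  have /sol : box b (const_mx (center i - h / 2) : 'rV[R]_1).
    by move=> j; rewrite mxE ger0_norm; lra.
  rewrite dot_rV1 !mxE addrAC subrr add0r opprB addrCA subrr addr0.
  rewrite tent_mid tent_mid' sub0r; nra.
by move: solR solL; rewrite -!(ler_pdivlMr _ _ lh) ler_norml; lra.
Qed.

Lemma card_cell_op_good_le eps x : 0 <= eps ->
  (#|[pred i | `[< MVI_solution eps (box b) (cell_op i) x >]]|)%:R <=
  16 * n%:R ^+ 2 * eps / (l * b ^+ 2) + 3 / 2.
Proof.
move=> eps0; set k := 16 * _ * _ / _.
have k0 : 0 <= k.
  by rewrite divr_ge0 ?mulr_ge0// ?exprn_ge0// ltW.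
rewrite (_ : k + 3 / 2 = (k + 1 / 2) + 1); last lra.
apply: card_ord_diam => [|i j]; first lra.
move=> /asboolP/cell_op_good gi /asboolP/cell_op_good gj.
have r0 := radius_gt0.
(* Hence solved centers lie within [(k + 1 / 2) * radius] of [x], and their indices differ by at
   most [k + 1 / 2]. *)
have kE : 4 * eps / (l * radius) = k * radius.
  by rewrite /k /radius; field; rewrite !gt_eqF// ltr0n.
have r2 : 0 < 2 * radius by rewrite mulr_gt0.
rewrite -(ler_pM2r r2) -centerB.
by move: gi gj; rewrite kE !ler_norml; lra.
Qed.

End Cells.

(** * The two lower bounds: choice of constants *)

Theorem proposition1p15 (R : realType) (L B : \bar R)
    (L_gt0 : (0 < L)%E) (B_gt0 : (0 < B)%E) :
  (forall p : R, 0 < p <= 1 ->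
     exists c eps0 : R, [/\ 0 < c, 0 < eps0 &
       forall eps : R, 0 < eps < eps0 ->
       forall (disp : measure_display) (W : measurableType disp)
         (P : probability W R) (A : W -> set 'rV[R]_1 -> strategy R 1)
         (q : nat),
       (forall X F, VI_Minty L B X F -> solves_whp P A q eps p X F) ->
       c / eps <= q%:R])
  /\
  (exists2 eps : R, 0 < eps &
     forall p : R, 0 < p <= 1 ->
     exists (c : R) (d0 : nat), 0 < c /\
       forall d : nat, (d0 <= d)%N ->
       forall (disp : measure_display) (W : measurableType disp)
         (P : probability W R) (A : W -> set 'rV[R]_d -> strategy R d)
         (q : nat),
       (forall X F, VI_Minty L B X F -> solves_whp P A q eps p X F) ->
       c * 2 ^+ d <= q%:R).
Proof.
have [l l0 lL] := gt0_fin_lb L_gt0; have [b b0 bB] := gt0_fin_lb B_gt0.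
have lb0 : 0 < l * b ^+ 2 by rewrite mulr_gt0// exprn_gt0.
split=> [p /andP[p0 p1]|].
  (* Chosen so that [n <= k / eps] bounds the main term of the solution count by [p * n / 4]. *)
  pose k := p * (l * b ^+ 2) / 64.
  have k0 : 0 < k by rewrite divr_gt0// mulr_gt0.
  (* The threshold gives [k / eps * p > 14], so [n * p > 13] after truncation; this absorbs the
     additive [3 / 2] and the rounding. *)
  exists (p * k / 4), (k * p / 14); split=> [||eps /andP[eps0 epsk]].
  - by rewrite divr_gt0// mulr_gt0.
  - by rewrite divr_gt0// mulr_gt0.
  move=> disp W P A q solA; pose n := Num.truncn (k / eps).
  have ke14 : 14 < k / eps * p.
    by rewrite mulrAC ltr_pdivlMr// mulrC -ltr_pdivlMr.
  have ke0 : 0 < k / eps by rewrite divr_gt0.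
  have /andP[nle nge] := truncn_itv (ltW ke0); rewrite -natr1 in nge.
  have npge : 13 < n%:R * p by nra.
  have n0 : (0 < n)%N by rewrite lt0n; apply: contraTneq npge => ->; lra.
  have := oracle_lower_bound (@cell_op_disjoint R l b n b0 n0)
    (fun x => card_cell_op_good_le l0 b0 n0 x (ltW eps0))
    (fun i => solA _ _ (VI_Minty_box lL bB
       (@cell_op_lipschitz R l b n l0 i (box b)) (cell_op_minty l0 b0 n0 i))).
  rewrite card_ord => lb.
  have kb : 16 * n%:R ^+ 2 * eps / (l * b ^+ 2) <= p * n%:R / 4.
    rewrite ler_pdivrMr//; move: nle; rewrite ler_pdivlMr// => nle.
    have -> : p * n%:R / 4 * (l * b ^+ 2) = 16 * n%:R * k by rewrite /k; field.
    have -> : 16 * n%:R ^+ 2 * eps = 16 * n%:R * (n%:R * eps) by ring.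
    by rewrite ler_wpM2l.
  rewrite (_ : p * k / 4 / eps = p * (k / eps) / 4); last first.
    by field; rewrite gt_eqF.
  by nra.
(* The accuracy of [orthant_op_good]: it depends on neither [p] nor [d]. *)
exists (l * b ^+ 2 / 16) => [|p /andP[p0 p1]]; first by rewrite divr_gt0.
(* For [d > 32 / p] the solution count [16 * 2 ^+ d / d] is at most half of [p * 2 ^+ d]. *)
exists (p / 2), (Num.truncn (32 / p)).+1; split=> [|d dd0 disp W P A q solA].
  by rewrite divr_gt0.
have d0 : (0 < d)%N by exact: leq_trans dd0.
have dR : 0 < d%:R :> R by rewrite ltr0n.
have dp : 32 < p * d%:R.
  rewrite mulrC -ltr_pdivrMr// (lt_le_trans (truncnS_gt _))// ler_nat//.
have := @oracle_lower_bound R d (box b) {ffun 'I_d -> bool} (orthant_op l b)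
  (l * b ^+ 2 / 16) p (16 * 2 ^+ d / d%:R) disp W P A q.
rewrite card_ffun card_bool card_ord natrX.
move=> lb; have {}lb : p * 2 ^+ d <= q%:R + 16 * 2 ^+ d / d%:R.
  apply: lb => [y s s'|x|s].
  - exact: orthant_op_disjoint.
  (* Chebyshev's bound needs [x] in the box; a point outside solves nothing. *)
  - case: (pselect (box b x)) => xb; last first.
      rewrite eq_card0 ?divr_ge0 ?mulr_ge0 ?exprn_ge0// => s.
      by rewrite inE; apply/asboolF => -[].
    apply: le_trans (card_dot_signs_le b0 xb d0); rewrite ler_nat.
    apply/subset_leq_card/fintype.subsetP => s; rewrite !inE.
    exact: orthant_op_good.
  - apply: solA; apply: VI_Minty_box lL bB _ (orthant_op_minty l0 b0 s).
    exact: orthant_op_lipschitz.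
have : 16 * 2 ^+ d / d%:R <= p / 2 * 2 ^+ d.
  have e0 : 0 < 2 ^+ d :> R by rewrite exprn_gt0.
  by rewrite ler_pdivrMr// mulrAC (ler_pM2r e0); lra.
lra.
Qed.
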